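(* Let $U:\mathcal A\to\mathbf{CRing}$ be a functor and suppose each object $A$ of $\mathcal A$ is equipped with an ideal $\mathfrak a_A\trianglelefteq U(A)$ such that $U(f)(\mathfrak a_A)\subseteq\mathfrak a_B$ for every $f:A\to B$ in $\mathcal A$. Then the ideals of $U(A)$ containing some power $\mathfrak a_A^n$ form (as $A$ varies) the kernel of an extensional presentation of the ideal form pulled back along $U$. The corresponding classical topology on $U(A)$ is the $\mathfrak a_A$-adic linear topology, and $U(A)$ is Hausdorff exactly when $$\bigcap_{n\ge0}\mathfrak a_A^n=0.$$ In particular: (i) for a fixed prime $p$, on $\mathbf{CRing}$ the choice $\mathfrak a_R=pR$ gives the usual $p$-adic topology; (ii) on the category of pairs $(R,I)$ ($I$ an ideal of the commutative ring $R$), with morphisms $f:(R,I)\to(S,J)$ the ring homomorphisms satisfying $f(I)\subseteq J$, the distinguished ideal gives the usual $I$-adic topology; (iii) on the category of Noetherian local rings and local homomorphisms, the maximal-ideal-adic topology is Hausdorff on every object.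
   Context: **Size.** The base category $\mathcal A$ is treated as small relative to a suitable universe. $\mathbf{CRing}$ is the category of commutative rings with identity (including the zero ring) and identity-preserving homomorphisms. **Forms.** A form over a category $\mathcal C$ with finite indexed meets is (equivalently) a functor $F:\mathcal C^{\mathrm{op}}\to\mathbf{Meet}_\top$, where $\mathbf{Meet}_\top$ is the category of meet-semilattices with top and maps preserving finite meets (including top). Elements of $F_X$ are called clusters over $X$; $f^*:F_Y\to F_X$ is the action of $f:X\to Y$; $\top_X$ is the top of $F_X$. For a small family $(A_i,f_i)_i$ with $f_i:X_i\to X$, $A_i\in F_{X_i}$, its final lift, if it exists, is the least $V\in F_X$ with $A_i\le f_i^*V$ for all $i$; one writes $V=\nabla_i(A_i,f_i)$ and calls the whole datum a final presentation. **Distributivity forms.** A distributivity form is a form $F$ with finite indexed meets together with a class of final presentations, called admissible, such that: (D1) every unit presentation $A=\nabla(A,1_X)$ is admissible, and admissibility is invariant under bijective reindexing; (D2) if $V=\nabla_i(A_i,f_i)$ and $A_i=\nabla_j(B_{ij},g_{ij})$ (all $i$) are admissible, so is $V=\nabla_{i,j}(B_{ij},f_ig_{ij})$; (D3) if $V=\nabla_i(A_i,f_i)$ is admissible and $C\in F_X$, then $V\wedge C=\nabla_i(A_i\wedge f_i^*C,f_i)$ is an admissible final presentation. The minimal distributivity is the one in which only unit presentations are admissible. A morphism $u:F\to G$ is a natural transformation with finite-meet-preserving components sending each admissible $V=\nabla_i(A_i,f_i)$ to an admissible final presentation $u_X(V)=\nabla_i(u_{X_i}(A_i),f_i)$. **Extensional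 presentations.** A morphism $n:F\to G$ is null if $n_X(A)=\top_X$ for all $X$ and $A\in F_X$. A relative kernel of $u:F\to G$ is a morphism $k:K\to F$ with $uk$ null through which every $h:H\to F$ with $uh$ null factors uniquely; relative cokernels are dual. $K\xrightarrow{k}F\xrightarrow{q}Q$ is short exact if $k$ is a kernel of $q$ and $q$ is a cokernel of $k$. An extensional presentation of $F$ is an isomorphism class, fixing $F$, of short exact sequences with middle term $F$; its kernel term is identified with the subform $K_X=\{A\in F_X\mid q_X(A)=\top_X\}$. If $F_X$ has a least cluster $\bot_X$, the object $X$ is Hausdorff for the extensional presentation if $\bot_X$ is the greatest lower bound of $K_X$ in $F_X$. **Pulled-back ideal form.** It is the form over $\mathcal A$ whose clusters over $A$ are the ideals of $U(A)$ ordered by inclusion, with $\top=U(A)$, $\bot=0$, meet $=\cap$, and $f^*J=U(f)^{-1}(J)$, with the minimal distributivity. ''$U(A)$ is Hausdorff'' means that the object $A$ is Hausdorff for the extensional presentation, i.e. the ideals in the kernel fibre over $A$ have zero intersection. The corresponding classical topology on $U(A)$ is the ring topology with neighbourhood basis of zero the ideals in the kernel fibre over $A$. By convention $\mathfrak a_A^0=U(A)$. *)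

(* Defs.v *)
From HB Require Import structures.
From mathcomp Require Import all_boot all_order all_algebra.
From mathcomp Require Import boolp classical_sets functions filter topology.

Set Implicit Arguments.
Unset Strict Implicit.
Unset Printing Implicit Defensive.

Import Order.TTheory GRing.Theory.

Local Open Scope classical_set_scope.
Local Open Scope ring_scope.

Record category := Category {
  ob :> Type;
  hom : ob -> ob -> Type;
  idm : forall X, hom X X;
  comp : forall X Y Z, hom Y Z -> hom X Y -> hom X Z;
  comp1m : forall X Y (f : hom X Y), comp (idm Y) f = f;
  compm1 : forall X Y (f : hom X Y), comp f (idm X) = f;
  compA : forall X Y Z W (h : hom Z W) (g : hom Y Z) (f : hom X Y),
    comp h (comp g f) = comp (comp h g) f }.

Arguments idm {c} _.
Arguments comp {c X Y Z} _ _.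

Record functor (C D : category) := Functor {
  fob :> C -> D;
  fmap : forall X Y, hom X Y -> hom (fob X) (fob Y);
  fmap1 : forall X, fmap (idm X) = idm (fob X);
  fmapM : forall X Y Z (g : hom Y Z) (f : hom X Y),
    fmap (comp g f) = comp (fmap g) (fmap f) }.

Arguments fmap {C D} _ {X Y} _.

Definition id_functor (C : category) : functor C C :=
  @Functor C C id (fun X Y => id) (fun X => erefl) (fun X Y Z g f => erefl).

(* Displays only steer notations and are all equal, so fixing one for the
   fibres of all forms loses no generality. *)
Fact form_display : Order.disp_t. Proof. exact: Order.Disp tt tt. Qed.

Record form (C : category) := Form {
  fib : C -> tMeetSemilatticeType form_display;
  pull : forall X Y, hom X Y -> fib Y -> fib X;
  pull1 : forall X (A : fib X), pull (idm X) A = A;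
  pullM : forall X Y Z (g : hom Y Z) (f : hom X Y) (A : fib Z),
    pull (comp g f) A = pull f (pull g A);
  pullI : forall X Y (f : hom X Y) (A B : fib Y),
    pull f (A `&` B)%O = (pull f A `&` pull f B)%O;
  pullT : forall X Y (f : hom X Y), pull f \top%O = \top%O }.

Arguments fib {C} _ _.
Arguments pull {C} _ {X Y} _ _.

Section FinalLifts.
Variables (C : category) (F : form C).

(* a pair (A, f) with f : src -> X and A a cluster over src *)
Record lifted (X : C) := Lifted {
  src : C;
  arr : hom src X;
  clu : fib F src }.

Definition lifted_unit (X : C) (A : fib F X) : lifted X := Lifted (idm X) A.

Definition lifted_comp (X : C) (s : lifted X) (t : lifted (src s)) : lifted X :=
  Lifted (comp (arr s) (arr t)) (clu t).

Definition lifted_meet (X : C) (D : fib F X) (s : lifted X) : lifted X :=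
  Lifted (arr s) (clu s `&` pull F (arr s) D)%O.

Definition is_final_lift (X : C) (I : Type) (S : I -> lifted X) (V : fib F X) :=
  (forall i, (clu (S i) <= pull F (arr (S i)) V)%O) /\
  (forall W, (forall i, (clu (S i) <= pull F (arr (S i)) W)%O) -> (V <= W)%O).

End FinalLifts.

(* [admissible S V] means that V = nabla_i (A_i, f_i) is an admissible final
   presentation, where S i = (A_i, f_i). *)
Record dform (C : category) := DForm {
  dform_form :> form C;
  admissible : forall (X : C) (I : Type),
    (I -> lifted dform_form X) -> fib dform_form X -> Prop;
  admissible_final : forall X I (S : I -> lifted dform_form X) V,
    admissible S V -> is_final_lift S V;
  admissible_unit : forall X (A : fib dform_form X),
    admissible (fun _ : unit => lifted_unit A) A;
  admissible_reindex : forall X I J (e : J -> I)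
      (S : I -> lifted dform_form X) V,
    bijective e -> admissible S V -> admissible (S \o e) V;
  admissible_comp : forall X I (J : I -> Type) (S : I -> lifted dform_form X)
      (T : forall i, J i -> lifted dform_form (src (S i))) V,
    admissible S V -> (forall i, admissible (T i) (clu (S i))) ->
    admissible (fun k : {i : I & J i} => lifted_comp (T (tag k) (tagged k))) V;
  admissible_meet : forall X I (S : I -> lifted dform_form X) V
      (D : fib dform_form X),
    admissible S V ->
    admissible (fun i => lifted_meet D (S i)) (V `&` D)%O }.

Arguments admissible {C} _ {X I} _ _.

Section MinimalDistributivity.
Variables (C : category) (F : form C).

(* the unit presentation V = nabla (V, 1_X), up to bijective reindexing *)
Definition unit_presentation (X : C) (I : Type) (S : I -> lifted F X)
    (V : fib F X) : Prop :=
  (exists i0 : I, forall i, i = i0) /\ (forall i, S i = lifted_unit V).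

Lemma unit_presentation_final X I (S : I -> lifted F X) V :
  unit_presentation S V -> is_final_lift S V.
Proof.
move=> [[i0 _] SV]; split=> [i|W]; first by rewrite SV /= pull1.
by move/(_ i0); rewrite SV /= pull1.
Qed.

Lemma unit_presentation_unit X (A : fib F X) :
  unit_presentation (fun _ : unit => lifted_unit A) A.
Proof. by split=> //; exists tt; case. Qed.

Lemma unit_presentation_reindex X I J (e : J -> I) (S : I -> lifted F X) V :
  bijective e -> unit_presentation S V -> unit_presentation (S \o e) V.
Proof.
move=> [g eK gK] [[i0 i0P] SV]; split; last by move=> j; apply: SV.
by exists (g i0) => j; rewrite -(i0P (e j)) eK.
Qed.

Lemma unit_presentation_comp X I (J : I -> Type) (S : I -> lifted F X)
    (T : forall i, J i -> lifted F (src (S i))) V :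
  unit_presentation S V -> (forall i, unit_presentation (T i) (clu (S i))) ->
  unit_presentation
    (fun k : {i : I & J i} => lifted_comp (T (tag k) (tagged k))) V.
Proof.
move=> [[i0 i0P] SV] TS; split.
  have [[j0 j0P] _] := TS i0; exists (existT _ i0 j0) => -[i j].
  by case: _ / (esym (i0P i)) j => j; rewrite (j0P j).
move=> [i j] /=; have [_ ->] := TS i.
by rewrite SV /lifted_comp /lifted_unit /= comp1m.
Qed.

Lemma unit_presentation_meet X I (S : I -> lifted F X) V (D : fib F X) :
  unit_presentation S V ->
  unit_presentation (fun i => lifted_meet D (S i)) (V `&` D)%O.
Proof.
by move=> [I1 SV]; split=> // i; rewrite SV /lifted_meet /= pull1.
Qed.

Definition minimal_dform : dform C :=
  DForm unit_presentation_final unit_presentation_unit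
    unit_presentation_reindex unit_presentation_comp unit_presentation_meet.

End MinimalDistributivity.

Record dmorphism (C : category) (F G : dform C) := DMorphism {
  dmap :> forall X, fib F X -> fib G X;
  dmap_pull : forall X Y (f : hom X Y) (A : fib F Y),
    dmap (pull F f A) = pull G f (dmap A);
  dmapI : forall X (A B : fib F X), dmap (A `&` B)%O = (dmap A `&` dmap B)%O;
  dmapT : forall X, dmap (\top%O : fib F X) = \top%O;
  dmap_admissible : forall X I (S : I -> lifted F X) (V : fib F X),
    admissible F S V ->
    admissible G (fun i => Lifted (arr (S i)) (dmap (clu (S i)))) (dmap V) }.

Arguments dmap {C F G} _ {X} _.

Section Exactness.
Variable C : category.

Program Definition dcomp (F G H : dform C) (v : dmorphism G H)
    (u : dmorphism F G) : dmorphism F H :=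
  @DMorphism C F H (fun X A => v X (u X A)) _ _ _ _.
Next Obligation. by move=> F G H v u X Y f A; rewrite /= !dmap_pull. Qed.
Next Obligation. by move=> F G H v u X A B; rewrite /= !dmapI. Qed.
Next Obligation. by move=> F G H v u X; rewrite /= !dmapT. Qed.
Next Obligation.
move=> F G H v u X I S V /(dmap_admissible u) /(dmap_admissible v); exact.
Qed.

Definition eqdm (F G : dform C) (u v : dmorphism F G) :=
  forall X (A : fib F X), u X A = v X A.

Definition null (F G : dform C) (u : dmorphism F G) :=
  forall X (A : fib F X), u X A = \top%O.

Definition is_kernel (F G K : dform C) (u : dmorphism F G)
    (k : dmorphism K F) :=
  null (dcomp u k) /\
  forall (H : dform C) (h : dmorphism H F), null (dcomp u h) ->
    exists2 h' : dmorphism H K, eqdm (dcomp k h') h &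
      forall h'', eqdm (dcomp k h'') h -> eqdm h'' h'.

Definition is_cokernel (F G Q : dform C) (u : dmorphism F G)
    (q : dmorphism G Q) :=
  null (dcomp q u) /\
  forall (H : dform C) (h : dmorphism G H), null (dcomp h u) ->
    exists2 h' : dmorphism Q H, eqdm (dcomp h' q) h &
      forall h'', eqdm (dcomp h'' q) h -> eqdm h'' h'.

(* A representative of an extensional presentation; everything below depends
   only on its isomorphism class. *)
Record ext_presentation (F : dform C) := ExtPresentation {
  ext_ker : dform C;
  ext_quo : dform C;
  ext_inj : dmorphism ext_ker F;
  ext_proj : dmorphism F ext_quo;
  ext_kernel : is_kernel ext_proj ext_inj;
  ext_cokernel : is_cokernel ext_inj ext_proj }.

Definition kernel_fibre (F : dform C) (E : ext_presentation F) (X : C) :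
    set (fib F X) :=
  [set A | ext_proj E X A = \top%O].

Arguments kernel_fibre {F} E X _.

Definition hausdorff_object (F : dform C) (E : ext_presentation F) (X : C) :=
  exists2 b : fib F X, (forall A, (b <= A)%O) & infimums (kernel_fibre E X) b.

End Exactness.

Arguments kernel_fibre {C F} E X _.
Arguments hausdorff_object {C F} E X.

(* The ideals of ring_quotient are proper and decidable; here the unit ideal
   must be allowed. *)
Definition is_ideal (R : comPzRingType) (I : set R) :=
  [/\ I 0, (forall x y, I x -> I y -> I (x + y)) &
      (forall a x, I x -> I (a * x))].

Record ideal (R : comPzRingType) := Ideal {
  ideal_set :> set R;
  ideal_setP : is_ideal ideal_set }.

HB.instance Definition _ (R : comPzRingType) := gen_eqMixin (ideal R).
HB.instance Definition _ (R : comPzRingType) := gen_choiceMixin (ideal R).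

Section Ideals.
Variable R : comPzRingType.
Implicit Types I J : ideal R.

Lemma ideal_ext I J : I = J :> set R -> I = J.
Proof.
case: I J => [I Ip] [J Jp] /= IJ; subst J.
by rewrite (Prop_irrelevance Ip Jp).
Qed.

Definition ideal_le I J : bool := `[< I `<=` J >].

Lemma ideal_le_refl : reflexive ideal_le.
Proof. by move=> I; apply/asboolP. Qed.

Lemma ideal_le_anti : antisymmetric ideal_le.
Proof.
by move=> I J /andP[/asboolP IJ /asboolP JI]; apply/ideal_ext/seteqP; split.
Qed.

Lemma ideal_le_trans : transitive ideal_le.
Proof.
by move=> J I K /asboolP IJ /asboolP JK; apply/asboolP; apply: subset_trans JK.
Qed.

HB.instance Definition _ := Order.Le_isPOrder.Build form_display (ideal R)
  ideal_le_refl ideal_le_anti ideal_le_trans.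

Lemma ideal_meet_subproof I J : is_ideal (I `&` J).
Proof.
case: I J => [I [I0 ID IM]] [J [J0 JD JM]]; split=> //=.
  by move=> x y [? ?] [? ?]; split; [apply: ID|apply: JD].
by move=> a x [? ?]; split; [apply: IM|apply: JM].
Qed.

Definition ideal_meet I J := Ideal (ideal_meet_subproof I J).

Lemma ideal_lexI I J K : (I <= ideal_meet J K)%O = (I <= J)%O && (I <= K)%O.
Proof.
apply/asboolP/andP => [|[/asboolP IJ /asboolP IK]]; last by rewrite subsetI.
by rewrite subsetI => -[? ?]; split; apply/asboolP.
Qed.

HB.instance Definition _ := Order.POrder_isMeetSemilattice.Build form_display
  (ideal R) ideal_lexI.

Lemma ideal_top_subproof : is_ideal [set: R].
Proof. by []. Qed.

Definition ideal_top := Ideal ideal_top_subproof.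

Lemma ideal_lex1 I : (I <= ideal_top)%O.
Proof. by apply/asboolP. Qed.

HB.instance Definition _ := Order.hasTop.Build form_display (ideal R)
  ideal_lex1.

Lemma ideal_gen_subproof (S : set R) : is_ideal (smallest (@is_ideal R) S).
Proof.
split=> [|x y Sx Sy|a x Sx] I IP; have [[I0 ID IM] _] := IP => //.
  exact: ID (Sx I IP) (Sy I IP).
exact: IM (Sx I IP).
Qed.

Definition ideal_gen (S : set R) := Ideal (ideal_gen_subproof S).

Definition idealM I J := ideal_gen [set x * y | x in I & y in J].

Definition idealX I n := iter n (idealM I) ideal_top.

Definition noetherian := forall I, exists s : seq R, I = ideal_gen [set` s].

Definition is_maximal I :=
  I <> ideal_top /\ forall J, I `<=` J -> J <> ideal_top -> J = I.

End Ideals.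

Arguments noetherian R : clear implicits.

Lemma ideal_pull_subproof (R S : comPzRingType) (f : {rmorphism R -> S})
  (J : ideal S) : is_ideal (f @^-1` J).
Proof.
case: J => [J [J0 JD JM]]; split=> /=; first by rewrite rmorph0.
  by move=> x y ? ?; rewrite rmorphD; apply: JD.
by move=> a x ?; rewrite rmorphM; apply: JM.
Qed.

Definition ideal_pull (R S : comPzRingType) (f : {rmorphism R -> S})
  (J : ideal S) : ideal R := Ideal (ideal_pull_subproof f J).

Section CommutativeRings.

Lemma rmorphism_ext (R S : comPzRingType) (f g : {rmorphism R -> S}) :
  f =1 g -> f = g.
Proof.
move=> /funext; case: f g => [f [[f1] [f2]]] [g [[g1] [g2]]] /= fg.
subst g; congr (GRing.RMorphism.Pack (GRing.RMorphism.Class _ _)).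
  by congr (GRing.isNmodMorphism.Axioms_ _); apply: Prop_irrelevance.
by congr (GRing.isMonoidMorphism.Axioms_ _); apply: Prop_irrelevance.
Qed.

Definition rmorphism_id (R : comPzRingType) : {rmorphism R -> R} := idfun.

Definition rmorphism_comp (R S T : comPzRingType) (g : {rmorphism S -> T})
  (f : {rmorphism R -> S}) : {rmorphism R -> T} := g \o f.

Program Definition CRing : category :=
  @Category comPzRingType (fun R S => {rmorphism R -> S})
    rmorphism_id rmorphism_comp _ _ _.
Next Obligation. by move=> R S f; apply: rmorphism_ext. Qed.
Next Obligation. by move=> R S f; apply: rmorphism_ext. Qed.
Next Obligation. by move=> R S T V h g f; apply: rmorphism_ext. Qed.

End CommutativeRings.

Section IdealForm.
Variables (C : category) (U : functor C CRing).

Definition ideal_fib (A : C) : tMeetSemilatticeType form_display :=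
  ideal (U A : comPzRingType).

Program Definition ideal_form0 : form C :=
  @Form C ideal_fib (fun A B f J => ideal_pull (fmap U f) J) _ _ _ _.
Next Obligation. by move=> A J; apply: ideal_ext; rewrite /= fmap1. Qed.
Next Obligation. by move=> X Y Z g f J; apply: ideal_ext; rewrite /= fmapM. Qed.
Next Obligation. by move=> X Y f I J; apply: ideal_ext. Qed.
Next Obligation. by move=> X Y f; apply: ideal_ext. Qed.

Definition ideal_form : dform C := minimal_dform ideal_form0.

Definition compatible (a : forall A : C, ideal (U A : comPzRingType)) :=
  forall (A B : C) (f : hom A B),
    (fmap U f : {rmorphism _ -> _}) @` a A `<=` a B.

Definition adic_kernel (a : forall A : C, ideal (U A : comPzRingType))
    (E : ext_presentation ideal_form) :=
  forall A : C, kernel_fibre E A =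
    [set J : ideal (U A : comPzRingType) | exists n, idealX (a A) n `<=` J].

End IdealForm.

Section RingTopologies.
Variable R : comPzRingType.

(* [Topological R] is the type of topologies on R; [Topological.Pack T] is the
   topological space R endowed with T. *)
Definition is_ring_topology (T : Topological R) :=
  let RT : topologicalType := Topological.Pack T in
  [/\ continuous (fun z : RT * RT => ((z.1 : R) + (z.2 : R)) : RT),
      continuous (fun x : RT => (- (x : R)) : RT) &
      continuous (fun z : RT * RT => ((z.1 : R) * (z.2 : R)) : RT)].

Definition has_nbhs0_basis (T : Topological R) (B : set (set R)) :=
  nbhs ((0 : R) : Topological.Pack T) = filter_from B id.

Definition adic_topology (I : ideal R) (T : Topological R) :=
  is_ring_topology T /\
  has_nbhs0_basis T [set (idealX I n : set R) | n in [set: nat]].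

Definition p_adic_topology (p : nat) (T : Topological R) :=
  is_ring_topology T /\
  has_nbhs0_basis T
    [set [set (p ^ n)%N%:R * x | x in [set: R]] | n in [set: nat]].

End RingTopologies.

Definition classical_topology (C : category) (U : functor C CRing)
    (E : ext_presentation (ideal_form U)) (A : C)
    (T : Topological (U A : comPzRingType)) :=
  is_ring_topology T /\
  has_nbhs0_basis T
    [set (J : set (U A : comPzRingType)) |
      J in (kernel_fibre E A : set (ideal (U A : comPzRingType)))].

Lemma pR_subproof (p : nat) (R : comPzRingType) :
  is_ideal [set p%:R * x | x in [set: R]].
Proof.
split; first by exists 0; rewrite ?mulr0.
  by move=> _ _ [x _ <-] [y _ <-]; exists (x + y); rewrite ?mulrDr.
by move=> a _ [x _ <-]; exists (a * x); rewrite // mulrCA.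
Qed.

Definition pR (p : nat) (R : CRing) : ideal R := Ideal (pR_subproof p R).

Section Pairs.

Definition pair_hom (R S : comPzRingType) (I : ideal R) (J : ideal S) :=
  {f : {rmorphism R -> S} | f @` I `<=` J}.

Lemma pair_hom_ext R S (I : ideal R) (J : ideal S) (f g : pair_hom I J) :
  sval f =1 sval g -> f = g.
Proof.
case: f g => [f fP] [g gP] /= /rmorphism_ext fg; subst g.
by rewrite (Prop_irrelevance fP gP).
Qed.

Program Definition pair_id (R : comPzRingType) (I : ideal R) : pair_hom I I :=
  exist _ (rmorphism_id R) _.
Next Obligation. by move=> R I _ [x Ix <-]. Qed.

Program Definition pair_comp (R S T : comPzRingType) (I : ideal R)
    (J : ideal S) (K : ideal T) (g : pair_hom J K) (f : pair_hom I J) :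
    pair_hom I K :=
  exist _ (rmorphism_comp (sval g) (sval f)) _.
Next Obligation.
move=> R S T I J K [g gP] [f fP] _ [x Ix <-] /=.
by apply: gP; exists (f x) => //; apply: fP; exists x.
Qed.

Record ideal_pair := IdealPair {
  pair_ring : comPzRingType;
  pair_ideal : ideal pair_ring }.

Program Definition IdealPairs : category :=
  @Category ideal_pair (fun P Q => pair_hom (pair_ideal P) (pair_ideal Q))
    (fun P => pair_id (pair_ideal P))
    (fun P Q S g f => pair_comp g f) _ _ _.
Next Obligation. by move=> P Q f; apply: pair_hom_ext. Qed.
Next Obligation. by move=> P Q f; apply: pair_hom_ext. Qed.
Next Obligation. by move=> P Q S T h g f; apply: pair_hom_ext. Qed.

Program Definition pair_forget : functor IdealPairs CRing :=
  @Functor IdealPairs CRing pair_ring (fun P Q f => sval f) _ _.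
Next Obligation. by []. Qed.
Next Obligation. by []. Qed.

Record noetherian_local_ring := NoetherianLocalRing {
  local_ring : comPzRingType;
  local_noetherian : noetherian local_ring;
  local_max : ideal local_ring;
  local_maxP : is_maximal local_max;
  local_max_unique : forall J : ideal local_ring,
    is_maximal J -> J = local_max }.

(* a ring homomorphism f is local when f(m) is contained in n *)
Program Definition NoetherianLocalRings : category :=
  @Category noetherian_local_ring
    (fun P Q => pair_hom (local_max P) (local_max Q))
    (fun P => pair_id (local_max P))
    (fun P Q S g f => pair_comp g f) _ _ _.
Next Obligation. by move=> P Q f; apply: pair_hom_ext. Qed.
Next Obligation. by move=> P Q f; apply: pair_hom_ext. Qed.
Next Obligation. by move=> P Q S T h g f; apply: pair_hom_ext. Qed.

Program Definition local_forget : functor NoetherianLocalRings CRing :=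
  @Functor NoetherianLocalRings CRing local_ring (fun P Q f => sval f) _ _.
Next Obligation. by []. Qed.
Next Obligation. by []. Qed.

End Pairs.

(* Main.v *)
Require Import Defs.
From HB Require Import structures.
From mathcomp Require Import all_boot all_order all_algebra.
From mathcomp Require Import boolp classical_sets functions filter topology.

Set Implicit Arguments.
Unset Strict Implicit.
Unset Printing Implicit Defensive.

Import Defs Order.TTheory GRing.Theory.

Local Open Scope classical_set_scope.
Local Open Scope ring_scope.

(** The ideals of [U A] that contain a power of [a A] form a filter of the
    meet-semilattice of all ideals, and compatibility of [a] makes these filters
    stable under pullback ([idealX_pull]).  For any form with the minimal
    distributivity, a pull-stable family of filters is the kernel of an
    extensional presentation ([filter_presentation]): the quotient identifies
    [x] and [y] when each lies below the other after meeting with an element of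
    the filter.  Upward closure of the filter shows that nothing else goes to
    the top, which gives the kernel; a meet-preserving map sending the filter to
    the top respects the congruence, which gives the cokernel.

    On the topological side, the powers of [a A] are cofinal in the kernel
    fibre, so both give the same neighbourhoods of zero, and these determine a
    ring topology ([ring_nbhsE]).  Conversely the cosets of any filter base of
    ideals define one ([linear_topology_ring]).  Cofinality also identifies the
    infimum of the kernel fibre with the intersection of the powers.  For
    [a R = pR] the powers are the ideals generated by the powers of [p]
    ([idealX_pR]).

    For Noetherian local rings it remains to see that the powers of the maximal
    ideal intersect in zero.  Krull's theorem ([krull_intersection]) says that
    an element [b] of the intersection of the powers of [I] satisfies
    [b = c * b] with [c] in [I]; in a local ring [1 - c] is a unit when [c] is
    in the maximal ideal, hence [b = 0]. *)

(** * Subobject and quotient of a meet-semilattice by a filter *)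

Section MeetFilters.
Variable L : tMeetSemilatticeType form_display.
Local Open Scope order_scope.

Record mfilter := MFilter {
  mfilter_set :> L -> Prop;
  mfilterT : mfilter_set \top;
  mfilterI : forall x y, mfilter_set x -> mfilter_set y ->
    mfilter_set (x `&` y);
  mfilterS : forall x y, x <= y -> mfilter_set x -> mfilter_set y }.

Variable P : mfilter.

Definition mfilter_sub := {x : L | P x}.

HB.instance Definition _ := gen_eqMixin mfilter_sub.
HB.instance Definition _ := gen_choiceMixin mfilter_sub.

Definition mfilter_sub_le (x y : mfilter_sub) : bool := sval x <= sval y.

Fact mfilter_sub_le_refl : reflexive mfilter_sub_le.
Proof. by move=> x; apply: lexx. Qed.

Fact mfilter_sub_le_anti : antisymmetric mfilter_sub_le.
Proof. by move=> [x Px] [y Py] /le_anti /= xy; apply: eq_exist. Qed.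

Fact mfilter_sub_le_trans : transitive mfilter_sub_le.
Proof. by move=> y x z; apply: le_trans. Qed.

HB.instance Definition _ := Order.Le_isPOrder.Build form_display mfilter_sub
  mfilter_sub_le_refl mfilter_sub_le_anti mfilter_sub_le_trans.

Definition mfilter_sub_meet (x y : mfilter_sub) : mfilter_sub :=
  exist _ (sval x `&` sval y) (mfilterI (svalP x) (svalP y)).

Fact mfilter_sub_lexI (x y z : mfilter_sub) :
  (x <= mfilter_sub_meet y z) = (x <= y) && (x <= z).
Proof. exact: lexI. Qed.

HB.instance Definition _ := Order.POrder_isMeetSemilattice.Build form_display
  mfilter_sub mfilter_sub_lexI.

Definition mfilter_sub_top : mfilter_sub := exist _ \top (mfilterT P).

Fact mfilter_sub_lex1 (x : mfilter_sub) : x <= mfilter_sub_top.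
Proof. exact: lex1. Qed.

HB.instance Definition _ := Order.hasTop.Build form_display mfilter_sub
  mfilter_sub_lex1.

(** The inequality forced by collapsing the filter to the top: [x] lies below
    [y] once it is met with some element of the filter.  Defining the
    congruence as the symmetric part of this preorder makes the order of the
    quotient a matter of transitivity. *)
Definition mfilter_le : rel L :=
  fun x y => `[< exists2 k, P k & x `&` k <= y >].

Lemma le_mfilter_le x y : x <= y -> mfilter_le x y.
Proof.
by move=> xy; apply/asboolP; exists \top; [apply: mfilterT|rewrite meetx1].
Qed.

Lemma mfilter_le_trans : transitive mfilter_le.
Proof.
move=> y x z /asboolP[k Pk xy] /asboolP[l Pl yz]; apply/asboolP.
exists (k `&` l); first exact: mfilterI.
by rewrite meetA (le_trans _ yz) // leI2.
Qed.

Lemma mfilter_leI x y z :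
  mfilter_le x (y `&` z) = mfilter_le x y && mfilter_le x z.
Proof.
apply/idP/andP => [xyz|[/asboolP[k Pk xy] /asboolP[l Pl xz]]].
  by split; apply: mfilter_le_trans xyz _; rewrite le_mfilter_le ?leIl ?leIr.
apply/asboolP; exists (k `&` l); first exact: mfilterI.
by rewrite lexI (le_trans _ xy) ?(le_trans _ xz) ?leI2 ?leIl ?leIr.
Qed.

Definition mfilter_cong : rel L :=
  fun x y => mfilter_le x y && mfilter_le y x.

Fact mfilter_cong_refl : reflexive mfilter_cong.
Proof. by move=> x; rewrite /mfilter_cong le_mfilter_le. Qed.

Fact mfilter_cong_sym : symmetric mfilter_cong.
Proof. by move=> x y; apply: andbC. Qed.

Fact mfilter_cong_trans : transitive mfilter_cong.
Proof.
move=> y x z /andP[xy yx] /andP[yz zy].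
by rewrite /mfilter_cong (mfilter_le_trans xy yz) (mfilter_le_trans zy yx).
Qed.

Canonical mfilter_cong_equiv :=
  EquivRel mfilter_cong mfilter_cong_refl mfilter_cong_sym mfilter_cong_trans.

Definition mfilter_quo : Type := {eq_quot mfilter_cong_equiv}%qT.

HB.instance Definition _ :=
  Choice.copy mfilter_quo {eq_quot mfilter_cong_equiv}%qT.

Definition mfilter_pi (x : L) : mfilter_quo :=
  (\pi_{eq_quot mfilter_cong_equiv} x)%qT.

Definition mfilter_repr (u : mfilter_quo) : L :=
  repr (u : {eq_quot mfilter_cong_equiv}%qT).

Lemma mfilter_reprK : cancel mfilter_repr mfilter_pi.
Proof. by move=> u; apply: reprK. Qed.

Lemma mfilter_piP x y : mfilter_pi x = mfilter_pi y <-> mfilter_cong x y.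
Proof. by split=> [/eqmodP //|xy]; apply/eqmodP. Qed.

Lemma mfilter_cong_repr x : mfilter_cong (mfilter_repr (mfilter_pi x)) x.
Proof. by apply/mfilter_piP; rewrite mfilter_reprK. Qed.

Definition mfilter_quo_le (u v : mfilter_quo) : bool :=
  mfilter_le (mfilter_repr u) (mfilter_repr v).

Fact mfilter_quo_le_refl : reflexive mfilter_quo_le.
Proof. by move=> u; apply: le_mfilter_le. Qed.

Fact mfilter_quo_le_anti : antisymmetric mfilter_quo_le.
Proof.
move=> u v uv; rewrite -[u]mfilter_reprK -[v]mfilter_reprK.
exact/mfilter_piP.
Qed.

Fact mfilter_quo_le_trans : transitive mfilter_quo_le.
Proof. by move=> v u w; apply: mfilter_le_trans. Qed.

HB.instance Definition _ := Order.Le_isPOrder.Build form_display mfilter_quo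
  mfilter_quo_le_refl mfilter_quo_le_anti mfilter_quo_le_trans.

Lemma mfilter_pi_le x y : (mfilter_pi x <= mfilter_pi y) = mfilter_le x y.
Proof.
have /andP[rx xr] := mfilter_cong_repr x.
have /andP[ry yr] := mfilter_cong_repr y.
apply/idP/idP => xy.
  exact: mfilter_le_trans (mfilter_le_trans xr xy) ry.
exact: mfilter_le_trans (mfilter_le_trans rx xy) yr.
Qed.

Definition mfilter_quo_meet (u v : mfilter_quo) : mfilter_quo :=
  mfilter_pi (mfilter_repr u `&` mfilter_repr v).

Fact mfilter_quo_lexI u v w :
  (u <= mfilter_quo_meet v w) = (u <= v) && (u <= w).
Proof.
by rewrite -{1}[u]mfilter_reprK [LHS]mfilter_pi_le mfilter_leI.
Qed.

HB.instance Definition _ := Order.POrder_isMeetSemilattice.Build form_display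
  mfilter_quo mfilter_quo_lexI.

Fact mfilter_quo_lex1 u : u <= mfilter_pi \top.
Proof. by rewrite -[u]mfilter_reprK mfilter_pi_le le_mfilter_le ?lex1. Qed.

HB.instance Definition _ := Order.hasTop.Build form_display mfilter_quo
  mfilter_quo_lex1.

Lemma mfilter_piI x y : mfilter_pi (x `&` y) = mfilter_pi x `&` mfilter_pi y.
Proof.
apply/le_anti/andP; split.
  by rewrite lexI; apply/andP; split;
    rewrite mfilter_pi_le le_mfilter_le ?leIl ?leIr.
set w := mfilter_pi x `&` mfilter_pi y.
rewrite -(mfilter_reprK w) mfilter_pi_le mfilter_leI -!mfilter_pi_le.
by rewrite mfilter_reprK leIl leIr.
Qed.

(** Exactly the filter is collapsed: upward closure prevents any further
    element from becoming the top. *)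
Lemma mfilter_pi_top x : mfilter_pi x = \top <-> P x.
Proof.
split=> [/mfilter_piP/andP[_ /asboolP[k Pk]]|Px].
  by rewrite meet1x => /mfilterS; apply.
apply/mfilter_piP/andP; split; first by rewrite le_mfilter_le ?lex1.
by apply/asboolP; exists x => //; rewrite leIr.
Qed.

End MeetFilters.

(** * The extensional presentation attached to a pull-stable filter *)

Section MinimalMorphisms.
Variables (C : category) (F : form C) (G : dform C).
Variable u : forall X, fib F X -> fib G X.
Hypothesis u_pull : forall X Y (f : hom X Y) A, u (pull F f A) = pull G f (u A).
Hypothesis uI : forall X (A B : fib F X), u (A `&` B)%O = (u A `&` u B)%O.
Hypothesis uT : forall X, u (\top%O : fib F X) = \top%O.

(** The minimal distributivity is the free one: a unit presentation is
    admissible in every distributivity form, so out of a minimal form the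
    condition on admissible presentations is automatic. *)
Program Definition minimal_morphism : dmorphism (minimal_dform F) G :=
  @DMorphism C (minimal_dform F) G u u_pull uI uT _.
Next Obligation.
move=> X I S V [[i0 i0P] SV].
have unit_bij : bijective (fun _ : I => tt).
  by exists (fun _ => i0) => [i|[]] //; rewrite -i0P.
have := admissible_reindex unit_bij (admissible_unit (u V)).
by congr (admissible G _ _); apply/funext => i /=; rewrite SV.
Qed.

End MinimalMorphisms.

Lemma dmap_le (C : category) (F G : dform C) (u : dmorphism F G) X
    (A B : fib F X) :
  (A <= B)%O -> (u X A <= u X B)%O.
Proof. by move=> /meet_idPl AB; rewrite -AB dmapI leIr. Qed.

Section FilterForms.
Variables (C : category) (F : form C) (K : forall X, mfilter (fib F X)).
Hypothesis K_pull : forall X Y (f : hom X Y) A, K Y A -> K X (pull F f A).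

Program Definition mfilter_form : form C :=
  @Form C (fun X => mfilter_sub (K X))
    (fun X Y f A => exist _ (pull F f (sval A)) (K_pull f (svalP A))) _ _ _ _.
Next Obligation. by move=> X [A KA]; apply: eq_exist; rewrite pull1. Qed.
Next Obligation.
by move=> X Y Z g f [A KA]; apply: eq_exist; rewrite pullM.
Qed.
Next Obligation.
by move=> X Y f [A KA] [B KB]; apply: eq_exist; rewrite pullI.
Qed.
Next Obligation. by move=> X Y f; apply: eq_exist; rewrite pullT. Qed.

Lemma mfilter_le_pull X Y (f : hom X Y) A B :
  mfilter_le (K Y) A B -> mfilter_le (K X) (pull F f A) (pull F f B).
Proof.
move=> /asboolP[k Kk /meet_idPl AB]; apply/asboolP; exists (pull F f k).
  exact: K_pull.
by rewrite -pullI -AB pullI leIr.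
Qed.

(** The value does not depend on the chosen representative:
    [mfilter_quotient_pull_pi]. *)
Definition mfilter_quotient_pull X Y (f : hom X Y) (u : mfilter_quo (K Y)) :
    mfilter_quo (K X) :=
  mfilter_pi (K X) (pull F f (mfilter_repr u)).

Lemma mfilter_quotient_pull_pi X Y (f : hom X Y) A :
  mfilter_quotient_pull f (mfilter_pi (K Y) A) = mfilter_pi (K X) (pull F f A).
Proof.
have /andP[rA Ar] := mfilter_cong_repr (K Y) A.
by apply/mfilter_piP/andP; split; apply: mfilter_le_pull.
Qed.

Program Definition mfilter_quotient_form : form C :=
  @Form C (fun X => mfilter_quo (K X)) mfilter_quotient_pull _ _ _ _.
Next Obligation.
by move=> X A; rewrite /mfilter_quotient_pull pull1 mfilter_reprK.
Qed.
Next Obligation.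
move=> X Y Z g f A.
by rewrite -[A]mfilter_reprK !mfilter_quotient_pull_pi pullM.
Qed.
Next Obligation.
move=> X Y f A B; rewrite -[A]mfilter_reprK -[B]mfilter_reprK -mfilter_piI.
by rewrite !mfilter_quotient_pull_pi pullI mfilter_piI.
Qed.
Next Obligation. by move=> X Y f; rewrite mfilter_quotient_pull_pi pullT. Qed.

End FilterForms.

Section FilterPresentation.
Variables (C : category) (F : form C) (K : forall X, mfilter (fib F X)).
Hypothesis K_pull : forall X Y (f : hom X Y) A, K Y A -> K X (pull F f A).

Definition filter_kernel : dform C := minimal_dform (mfilter_form K_pull).
Definition filter_quotient : dform C :=
  minimal_dform (mfilter_quotient_form K_pull).

Definition filter_inj : dmorphism filter_kernel (minimal_dform F) :=
  @minimal_morphism C (mfilter_form K_pull) (minimal_dform F)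
    (fun X A => sval A) (fun _ _ _ _ => erefl) (fun _ _ _ => erefl)
    (fun _ => erefl).

Program Definition filter_proj : dmorphism (minimal_dform F) filter_quotient :=
  @minimal_morphism C F filter_quotient (fun X => mfilter_pi (K X)) _ _ _.
Next Obligation. by move=> X Y f A; rewrite /= mfilter_quotient_pull_pi. Qed.
Next Obligation. by move=> X A B; rewrite /= mfilter_piI. Qed.
Next Obligation. by []. Qed.

(** A partial inverse of the inclusion on lifted clusters.  The type of the
    cluster depends on the source object, so injectivity is obtained from a
    retraction instead of by comparing components. *)
Definition lifted_to_filter X (s : lifted F X) :
    option (lifted (mfilter_form K_pull) X) :=
  if pselect (K (src s) (clu s)) is left Ks
  then Some (@Lifted C (mfilter_form K_pull) X (src s) (arr s)
               (exist _ (clu s) Ks))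
  else None.

Lemma filter_lifted_inj X :
  injective (fun s : lifted (mfilter_form K_pull) X =>
    @Lifted C F X (src s) (arr s) (sval (clu s))).
Proof.
apply: (@pcan_inj _ _ _ (@lifted_to_filter X)) => -[Y f [A KA]].
rewrite /lifted_to_filter /=; case: pselect => // KA'.
by rewrite (Prop_irrelevance KA' KA).
Qed.

(** A morphism annihilated by the quotient takes values in the filter.  The
    factorisation preserves admissibility because its target inherits unit
    presentations back from the ambient form ([filter_lifted_inj]). *)
Lemma filter_inj_kernel : is_kernel filter_proj filter_inj.
Proof.
split=> [X [A KA]|H h hK]; first exact/mfilter_pi_top.
have Kh X A : K X (h X A) by apply/mfilter_pi_top/hK.
pose h0 X A : mfilter_sub (K X) := exist _ (h X A) (Kh X A).
have h0_adm X I (S : I -> lifted H X) V : admissible H S V ->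
    admissible filter_kernel
      (fun i => @Lifted C filter_kernel X _ (arr (S i)) (h0 _ (clu (S i))))
      (h0 _ V).
  move=> /(dmap_admissible h)[I1 SV]; split=> // i.
  by apply: filter_lifted_inj; apply: SV.
have h0_pull X Y (f : hom X Y) A :
    h0 X (pull H f A) = pull filter_kernel f (h0 Y A).
  by apply: eq_exist; apply: (dmap_pull h).
have h0I X A B : h0 X (A `&` B)%O = (h0 X A `&` h0 X B)%O.
  by apply: eq_exist; apply: (dmapI h).
have h0T X : h0 X \top%O = \top%O by apply: eq_exist; apply: (dmapT h).
exists (@DMorphism C H filter_kernel h0 h0_pull h0I h0T h0_adm) => //.
move=> h' hh' X A.
have := hh' X A; rewrite /= /h0; case: (h' X A) => /= B KB eB.
exact: eq_exist.
Qed.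

(** A morphism [h] sending the filter to the top satisfies
    [h x = h (x /\ k) <= h y] as soon as [x /\ k <= y] with [k] in the filter,
    so it is constant on the classes of the congruence. *)
Lemma filter_proj_cokernel : is_cokernel filter_inj filter_proj.
Proof.
split=> [X [A KA]|H h hK]; first exact/mfilter_pi_top.
have h_le X A B : mfilter_le (K X) A B -> (h X A <= h X B)%O.
  move=> /asboolP[k Kk /(dmap_le h)]; rewrite dmapI.
  by have /= -> := hK X (exist _ k Kk); rewrite meetx1.
pose h0 X (u : mfilter_quo (K X)) := h X (mfilter_repr u).
have h0_pi X A : h0 X (mfilter_pi (K X) A) = h X A.
  have /andP[rA Ar] := mfilter_cong_repr (K X) A.
  by apply/le_anti; rewrite !h_le.
have h0_pull X Y (f : hom X Y) (u : fib (mfilter_quotient_form K_pull) Y) :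
    h0 X (pull (mfilter_quotient_form K_pull) f u) = pull H f (h0 Y u).
  by rewrite h0_pi (dmap_pull h).
have h0I X (u v : fib (mfilter_quotient_form K_pull) X) :
    h0 X (u `&` v)%O = (h0 X u `&` h0 X v)%O.
  by rewrite -[u]mfilter_reprK -[v]mfilter_reprK -mfilter_piI !h0_pi dmapI.
have h0T X : h0 X (\top%O : fib (mfilter_quotient_form K_pull) X) = \top%O.
  by rewrite h0_pi dmapT.
exists (minimal_morphism h0_pull h0I h0T) => [X A|h' hh' X u].
  exact: h0_pi.
by rewrite -[u]mfilter_reprK [RHS]h0_pi; apply: hh'.
Qed.

Definition filter_presentation : ext_presentation (minimal_dform F) :=
  ExtPresentation filter_inj_kernel filter_proj_cokernel.

Lemma filter_presentation_fibre X :
  kernel_fibre filter_presentation X = [set A | K X A].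
Proof. by apply/seteqP; split=> A /mfilter_pi_top. Qed.

End FilterPresentation.

(** * Powers of ideals *)

Section IdealTheory.
Variable R : comPzRingType.
Implicit Types (I J K : ideal R) (S : set R) (x y z : R).

Lemma ideal0 I : ideal_set I 0. Proof. by case: (ideal_setP I). Qed.
Lemma idealD I x y : ideal_set I x -> ideal_set I y -> ideal_set I (x + y).
Proof. by case: (ideal_setP I) => _ + _; apply. Qed.
Lemma ideal_mull I x y : ideal_set I y -> ideal_set I (x * y).
Proof. by case: (ideal_setP I) => _ _; apply. Qed.
Lemma ideal_mulr I x y : ideal_set I x -> ideal_set I (x * y).
Proof. by rewrite mulrC; apply: ideal_mull. Qed.
Lemma idealN I x : ideal_set I x -> ideal_set I (- x).
Proof. by rewrite -mulN1r; apply: ideal_mull. Qed.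
Lemma idealB I x y : ideal_set I x -> ideal_set I y -> ideal_set I (x - y).
Proof. by move=> Ix Iy; apply: idealD => //; apply: idealN. Qed.

Lemma sub_ideal_gen S : S `<=` ideal_gen S.
Proof. by move=> x Sx J [_]; apply. Qed.

Lemma ideal_gen_sub S I : S `<=` I -> ideal_gen S `<=` I.
Proof. exact: smallest_sub (ideal_setP I). Qed.

Lemma idealM_mem I J x y :
  ideal_set I x -> ideal_set J y -> ideal_set (idealM I J) (x * y).
Proof. by move=> Ix Jy; apply: sub_ideal_gen; exists x => //; exists y. Qed.

Lemma idealM_sub I J K :
  (forall x y, ideal_set I x -> ideal_set J y -> ideal_set K (x * y)) ->
  idealM I J `<=` K.
Proof.
by move=> IJK; apply: ideal_gen_sub => _ [x Ix [y Jy <-]]; apply: IJK.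
Qed.

Lemma idealX_decr I m n : (m <= n)%N -> idealX I n `<=` idealX I m.
Proof.
move=> /subnK <-; elim: (n - m)%N => [//|k IH].
by apply: idealM_sub => x y _ /IH; apply: ideal_mull.
Qed.

End IdealTheory.

Lemma idealX_pull (R S : comPzRingType) (f : {rmorphism R -> S})
    (I : ideal R) (J : ideal S) n :
  f @` I `<=` J -> idealX I n `<=` ideal_pull f (idealX J n).
Proof.
move=> fIJ; elim: n => [//|n IH]; apply: idealM_sub => x y Ix /IH Jy /=.
by rewrite rmorphM; apply: idealM_mem => //; apply: fIJ; exists x.
Qed.

Lemma idealX_pR (p : nat) (R : comPzRingType) n :
  idealX (pR p R) n = [set (p ^ n)%N%:R * x | x in [set: R]] :> set R.
Proof.
elim: n => [|n IH].
  by apply/seteqP; split=> // x _; exists x; rewrite ?mul1r.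
apply/seteqP; split=> [|_ [x _ <-]].
  have -> : [set (p ^ n.+1)%N%:R * x | x in [set: R]] = pR (p ^ n.+1) R.
    by [].
  apply: idealM_sub => _ y [x _ <-]; rewrite IH => -[z _ <-].
  by exists (x * z); rewrite // expnS natrM mulrACA.
rewrite expnS natrM -mulrA; apply: idealM_mem.
  by exists 1; rewrite ?mulr1.
by rewrite IH; exists x.
Qed.

(** * Ring topologies and their neighbourhoods of zero *)

Section RingTopologyTheory.
Variable R : comPzRingType.
Implicit Types (T : Topological R) (x : R) (A : set R).

Let nb T x : set (set R) := @nbhs R (Topological.Pack T) x.

(** Translations are continuous, with translations as inverses, so a ring
    topology is determined by its neighbourhoods of zero. *)
Lemma ring_nbhsE T x A : is_ring_topology T ->
  nb T x A <-> nb T 0 [set y | A (x + y)].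
Proof.
move=> [addT _ _]; split=> [|A0].
  rewrite -{1}[x]addr0 => /(addT (x, 0))[[P Q] /= [Px Q0] PQ].
  apply: filterS Q0 => y Qy; apply: (PQ (x, y)); split=> //=.
  exact: @nbhs_singleton (Topological.Pack T) _ _ Px.
have: nb T (- x + x) [set y | A (x + y)] by rewrite addNr.
move=> /(addT (- x, x))[[P Q] /= [Px Qx] PQ].
apply: filterS Qx => y Qy.
have /= := PQ (- x, y) (conj (@nbhs_singleton (Topological.Pack T) _ _ Px) Qy).
by rewrite addNKr.
Qed.

Lemma ring_topology_open T T' B :
  is_ring_topology T -> has_nbhs0_basis T B ->
  is_ring_topology T' -> has_nbhs0_basis T' B ->
  @open (Topological.Pack T) = @open (Topological.Pack T').
Proof.
move=> ringT TB ringT' TB'.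
rewrite !openE; apply/seteqP; split=> A oA x /oA.
  move=> /(ring_nbhsE _ _ ringT).1; rewrite /nb TB -TB'.
  exact: (ring_nbhsE _ _ ringT').2.
move=> /(ring_nbhsE _ _ ringT').1; rewrite /nb TB' -TB.
exact: (ring_nbhsE _ _ ringT).2.
Qed.

(** If the cosets [x + J] and [y + J] meet then [x - y] lies in [J]. *)
Lemma ring_topology_hausdorff T (B : set (ideal R)) :
  is_ring_topology T -> has_nbhs0_basis T [set (J : set R) | J in B] ->
  \bigcap_(J in B) (J : set R) `<=` [set 0] ->
  hausdorff_space (Topological.Pack T).
Proof.
move=> ringT TB B0 x y xy; apply: (@subr0_eq R); apply: B0 => J BJ.
have TJ z : nb T z [set z + t | t in J].
  apply/(ring_nbhsE _ _ ringT).2; rewrite /nb TB; exists J; first by exists J.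
  by move=> t Jt; exists t.
have [_ [[s Js <-] [t Jt]]] := xy _ _ (TJ x) (TJ y).
move=> ytxs; suff -> : x - y = t - s by apply: idealB.
by apply/(canRL (addrK _))/(addIr y); rewrite addrAC subrK -ytxs addrC.
Qed.

(* Cosets of the members of a filter base of ideals form a base of
   neighbourhoods. *)
Section LinearTopology.
Variable K : set (ideal R).
Hypothesis K_nonempty : K !=set0.
Hypothesis K_directed : forall I J, K I -> K J ->
  exists2 L, K L & L `<=` I `&` J.

Definition linear_nbhs x : set (set R) :=
  filter_from K (fun J : ideal R => [set x + y | y in (J : set R)]).

Fact linear_nbhs_filter x : ProperFilter (linear_nbhs x).
Proof.
apply: filter_from_proper; last first.
  by move=> J _; exists (x + 0); exists 0 => //; apply: ideal0.
apply: filter_from_filter => // I J KI KJ.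
have [L KL LIJ] := K_directed KI KJ; exists L => // _ [y /LIJ[Iy Jy] <-].
by split; exists y.
Qed.

Fact linear_nbhs_singleton x A : linear_nbhs x A -> A x.
Proof.
by move=> [J _]; apply; exists 0; rewrite ?addr0 //; apply: ideal0.
Qed.

Fact linear_nbhs_nbhs x A :
  linear_nbhs x A -> linear_nbhs x (linear_nbhs^~ A).
Proof.
move=> [J KJ JA]; exists J => // _ [y Jy <-]; exists J => // _ [z Jz <-].
by rewrite -addrA; apply: JA; exists (y + z) => //; apply: idealD.
Qed.

Definition linear_nbhsType : nbhsType :=
  HB.pack (R : Type) (Choice.class R) (hasNbhs.Build R linear_nbhs).

Definition linear_topology : Topological R := Topological.class
  (HB.pack_for topologicalType (R : Type) (Nbhs.class linear_nbhsType)
    (Nbhs_isNbhsTopological.Build linear_nbhsType linear_nbhs_filter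
       linear_nbhs_singleton linear_nbhs_nbhs)).

Lemma linear_topology_basis :
  has_nbhs0_basis linear_topology [set (J : set R) | J in K].
Proof.
apply/seteqP; split=> A.
  move=> [J KJ JA]; exists J; first by exists J.
  by move=> y Jy; apply: JA; exists y; rewrite ?add0r.
move=> [_ [J KJ <-] JA]; exists J => // _ [y Jy <-].
by rewrite add0r; apply: JA.
Qed.

(** Multiplication is continuous because
    [(x + s) * (y + t) = x * y + (x * t + s * (y + t))], whose last two terms
    lie in every ideal containing [s] and [t]. *)
Lemma linear_topology_ring : is_ring_topology linear_topology.
Proof.
have J_nbhs (J : ideal R) x : K J ->
  nb linear_topology x [set x + y | y in (J : set R)] by exists J.
split.
- move=> [x y] A /= [J KJ JA].
  exists ([set x + z | z in (J : set R)], [set y + z | z in (J : set R)]).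
    by split; apply: J_nbhs.
  move=> _ [/= [s Js <-] [t Jt <-]]; apply: JA; exists (s + t).
    exact: idealD.
  by rewrite addrACA.
- move=> x A /= [J KJ JA]; exists J => // _ [s Js <-] /=; apply: JA.
  by exists (- s); rewrite ?opprD //; apply: idealN.
- move=> [x y] A /= [J KJ JA].
  exists ([set x + z | z in (J : set R)], [set y + z | z in (J : set R)]).
    by split; apply: J_nbhs.
  move=> _ [/= [s Js <-] [t Jt <-]]; apply: JA.
  exists (x * t + s * (y + t)).
    by apply: idealD; [apply: ideal_mull|apply: ideal_mulr].
  by rewrite addrA -mulrDr -mulrDl.
Qed.

End LinearTopology.
End RingTopologyTheory.

(** * Krull's intersection theorem *)

Section Krull.
Variable R : comPzRingType.
Implicit Types (I J K : ideal R) (S : set R) (b c x y z : R).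

Fact ideal_colon_subproof J x : is_ideal [set y | ideal_set J (x * y)].
Proof.
split=> [|y z Jy Jz|a y Jy] /=; first by rewrite mulr0; apply: ideal0.
  by rewrite mulrDr; apply: idealD.
by rewrite mulrCA; apply: ideal_mull.
Qed.

Definition ideal_colon J x := Ideal (ideal_colon_subproof J x).

Fact idealZ_subproof b I : is_ideal [set b * x | x in (I : set R)].
Proof.
split; first by exists 0; rewrite ?mulr0 //; apply: ideal0.
  move=> _ _ [x Ix <-] [y Iy <-]; exists (x + y); rewrite ?mulrDr //.
  exact: idealD.
by move=> a _ [x Ix <-]; exists (a * x); rewrite 1?mulrCA //; apply: ideal_mull.
Qed.

Definition idealZ b I := Ideal (idealZ_subproof b I).

Fact ideal_add_subproof I J :
  is_ideal [set x + y | x in (I : set R) & y in (J : set R)].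
Proof.
split.
- exists 0; first exact: ideal0.
  by exists 0; rewrite ?addr0 //; apply: ideal0.
- move=> _ _ [x Ix [y Jy <-]] [z Iz [t Jt <-]]; exists (x + z).
    exact: idealD.
  by exists (y + t); rewrite 1?addrACA //; apply: idealD.
- move=> a _ [x Ix [y Jy <-]]; exists (a * x); first exact: ideal_mull.
  by exists (a * y); rewrite ?mulrDr //; apply: ideal_mull.
Qed.

Definition ideal_add I J := Ideal (ideal_add_subproof I J).

(** A containment of powers may be tested on monomials in the generators: each
    factor is reduced to a generator separately, by
    passing to a colon ideal. *)
Lemma idealX_gen_sub S n K :
  (forall t : seq R, size t = n -> [set` t] `<=` S ->
     ideal_set K (\prod_(x <- t) x)) ->
  idealX (ideal_gen S) n `<=` K.
Proof.
elim: n K => [|n IH] K HK.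
  move=> x _; rewrite -[x]mulr1; apply: ideal_mull.
  by have := HK [::]; rewrite big_nil; apply.
apply: idealM_sub => x y Sx Sy; rewrite mulrC.
suff : ideal_gen S `<=` ideal_colon K y by apply.
apply: ideal_gen_sub => {Sx}x Sx; rewrite /= mulrC.
suff : idealX (ideal_gen S) n `<=` ideal_colon K x by apply.
apply: IH => t sz_t tS /=; have := HK (x :: t); rewrite big_cons; apply.
  by rewrite /= sz_t.
by move=> z /=; rewrite inE => /predU1P[->|/tS].
Qed.

(** Pigeonhole: a monomial of large degree in finitely many elements contains a
    high power of one of them. *)
Lemma prod_pigeonhole J (s : seq R) :
  (forall x, x \in s -> exists n, ideal_set J (x ^+ n)) ->
  exists n, forall t : seq R, {subset t <= s} -> (n <= size t)%N ->
    ideal_set J (\prod_(x <- t) x).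
Proof.
elim: s => [_|x s IH sJ].
  exists 1%N => -[//|y t] /(_ y); rewrite mem_head => /(_ isT); discriminate.
have [|n nJ] := IH; first by move=> y ys; apply: sJ; rewrite inE ys orbT.
have [k xkJ] := sJ x (mem_head _ _).
exists (k + n)%N => t ts sz_t; rewrite (bigID (pred1 x)) /=.
rewrite (eq_bigr (fun=> x)) => [|y /eqP //].
(* The factors equal to [x] are collected into a power of [x]. *)
rewrite big_const_seq -Monoid.iteropE -[iterop _ _ _ _]/(x ^+ _).
rewrite -[X in _ * X]big_filter.
have [le_k|lt_k] := leqP k (count (pred1 x) t).
  by rewrite -(subnK le_k) exprD -mulrA; apply: ideal_mull; apply: ideal_mulr.
apply: ideal_mull; apply: nJ => [y|].
  by rewrite mem_filter => /andP[/negbTE yx /ts]; rewrite inE yx.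
rewrite size_filter -(leq_add2l k) (leq_trans sz_t) //.
by rewrite -(count_predC (pred1 x) t) leq_add2r ltnW.
Qed.

Lemma idealX_sub_of_powers I J : noetherian R ->
  (forall x, ideal_set I x -> exists n, ideal_set J (x ^+ n)) ->
  exists n, idealX I n `<=` J.
Proof.
move=> /(_ I)[s ->] IJ.
have [|n nJ] := @prod_pigeonhole J s.
  by move=> x xs; apply: IJ; apply: sub_ideal_gen.
by exists n; apply: idealX_gen_sub => t sz_t ts; apply: nJ; rewrite ?sz_t.
Qed.

(** The union of the chain is finitely generated, and its generators all occur
    at some stage. *)
Lemma noetherian_acc (J : nat -> ideal R) : noetherian R ->
  (forall n, J n `<=` J n.+1) -> exists N, forall n, J n `<=` J N.
Proof.
move=> noethR JS.
have J_le m n : (m <= n)%N -> J m `<=` J n.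
  by move=> /subnK <-; elim: (n - m)%N => [//|k IH] x /IH /JS.
have U_ideal : is_ideal (\bigcup_n (J n : set R)).
  split=> [|x y [m _ Jx] [n _ Jy]|a x [n _ Jx]].
  - by exists 0%N => //; apply: ideal0.
  - exists (maxn m n) => //; apply: idealD.
      exact: J_le (leq_maxl _ _) _ Jx.
    exact: J_le (leq_maxr _ _) _ Jy.
  - by exists n => //; apply: ideal_mull.
have [s UsE] := noethR (Ideal U_ideal).
have Us : \bigcup_n (J n : set R) = ideal_gen [set` s] by rewrite -UsE.
have [N sN] : exists N, [set` s] `<=` J N.
  have : [set` s] `<=` \bigcup_n (J n : set R).
    by rewrite Us; apply: sub_ideal_gen.
  elim: {UsE Us} s => [|x s IH] sU; first by exists 0%N.
  have [|N sN] := IH.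
    by move=> y ys; apply: sU; rewrite /= inE [_ \in s]ys orbT.
  have [n _ Jx] := sU x (mem_head _ _).
  exists (maxn n N) => y /=; rewrite inE => /predU1P[->|/sN].
    exact: J_le (leq_maxl _ _) _ Jx.
  exact: J_le (leq_maxr _ _) _.
by exists N => n x Jx; apply: (ideal_gen_sub sN); rewrite -Us; exists n.
Qed.

(** Without a maximal member, choosing ever larger ideals would produce a chain
    that never stops. *)
Lemma noetherian_maximal (P : ideal R -> Prop) I : noetherian R -> P I ->
  exists2 J, P J & forall K, P K -> J `<=` K -> K `<=` J.
Proof.
move=> noethR PI; apply: contrapT => noJ.
have /choice[f fP] J : exists K, P J -> [/\ P K, J `<=` K & ~ K `<=` J].
  have [PJ|nPJ] := pselect (P J); last by exists J.
  apply: contrapT => noK; apply: noJ; exists J => // K PK JK.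
  by apply: contrapT => nKJ; apply: noK; exists K.
have iterP n : P (iter n f I) by elim: n => //= n /fP[].
have [|N maxN] := @noetherian_acc (fun n => iter n f I) noethR.
  by move=> n; have [] := fP _ (iterP n).
by have [_ _] := fP _ (iterP N); apply; apply: (maxN N.+1).
Qed.

(** Among the ideals [J] with [I b <= J] and [J /\ (b) <= I b] take a maximal
    one.  For [x] in [I] the chain [(J : x ^+ n)] stops at some [N], and then
    [J + (x ^+ N)] satisfies the same two conditions: if [y = j + s x ^+ N] is a
    multiple of [b] then [x y] is in [I b], hence in [J], so [s x ^+ N.+1] is in
    [J], so [s x ^+ N] already is, and [y] is in [J].  By maximality [x ^+ N] is
    in [J].  As [I] is finitely generated, [J] contains a power of [I], hence
    [b], and the second condition puts [b] in [I b]. *)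
Lemma krull_intersection I b : noetherian R ->
  (forall n, ideal_set (idealX I n) b) -> exists2 c, ideal_set I c & b = c * b.
Proof.
move=> noethR bX.
pose P J := (forall c, ideal_set I c -> ideal_set J (c * b)) /\
  (forall r, ideal_set J (r * b) -> exists2 c, ideal_set I c & r * b = c * b).
have [|J [IbJ JbI] J_max] := @noetherian_maximal P (idealZ b I) noethR.
  split=> [c Ic|r [c Ic <-]]; first by exists c; rewrite 1?mulrC.
  by exists c; rewrite 1?mulrC.
have Jpow x : ideal_set I x -> exists n, ideal_set J (x ^+ n).
  move=> Ix.
  have [|N maxN] := @noetherian_acc (fun n => ideal_colon J (x ^+ n)) noethR.
    by move=> n r /= Jr; rewrite exprS -mulrA; apply: ideal_mull.
  pose K := ideal_add J (idealZ (x ^+ N) (ideal_top R)).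
  have JK : J `<=` K.
    move=> y Jy; exists y => //; exists 0; rewrite ?addr0 //; exact: ideal0.
  exists N; apply: (J_max K) => //; last first.
    exists 0; first exact: ideal0.
    by exists (x ^+ N); rewrite ?add0r //; exists 1; rewrite ?mulr1.
  split=> [c Ic|r [j Jj [_ [s _ <-]] jrb]]; first exact/JK/IbJ.
  apply: JbI; rewrite -jrb; apply: idealD => //; apply: (maxN N.+1) => /=.
  have -> : x ^+ N.+1 * s = x * r * b - x * j.
    by rewrite -mulrA -jrb mulrDr addrAC subrr add0r exprS mulrA.
  apply: idealB; last exact: ideal_mull.
  by apply: IbJ; apply: ideal_mulr.
have [n XJ] := idealX_sub_of_powers noethR Jpow.
by have [|c Ic] := JbI 1; rewrite ?mul1r; [apply/XJ/bX|exists c].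
Qed.

(** Were [1 - c] not a unit, an ideal maximal among the proper ones containing
    it would be [m], and would contain [c] too. *)
Lemma local_one_minus_unit (m : ideal R) c : noetherian R ->
  (forall J, is_maximal J -> J = m) -> ideal_set m c ->
  exists u, u * (1 - c) = 1.
Proof.
move=> noethR m_uniq mc; apply: contrapT => no_u.
have unit_top J : ideal_set J 1 -> J = ideal_top R.
  move=> J1; apply: ideal_ext; apply/seteqP; split=> // x _.
  by rewrite -[x]mulr1; apply: ideal_mull.
pose P J := ideal_set J (1 - c) /\ ~ ideal_set J 1.
have [|J [Jc J1] J_max] :=
    @noetherian_maximal P (idealZ (1 - c) (ideal_top R)) noethR.
  split; first by exists 1; rewrite ?mulr1.
  by move=> [u _ cu]; apply: no_u; exists u; rewrite mulrC.
have Jm : J = m.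
  apply: m_uniq; split=> [JT|K JK KT]; first by apply: J1; rewrite JT.
  apply: ideal_ext; apply/seteqP; split=> //.
  apply: J_max => //; split; first exact: JK.
  by move=> /unit_top.
by apply: J1; rewrite -[1](subrK c); apply: idealD => //; rewrite Jm.
Qed.

Lemma krull_intersection_local (m : ideal R) : noetherian R ->
  (forall J, is_maximal J -> J = m) ->
  \bigcap_n (idealX m n : set R) = [set 0].
Proof.
move=> noethR m_uniq; apply/seteqP; split=> [b bX|_ -> n _]; last exact: ideal0.
have [|c mc bE] := @krull_intersection m b noethR.
  by move=> n; apply: bX.
have [u uc] := local_one_minus_unit noethR m_uniq mc.
by rewrite /= -[b]mul1r -uc -mulrA mulrBl mul1r -bE subrr mulr0.
Qed.

End Krull.

(** * The adic filter and the presentation it defines *)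

Section AdicFilter.
Variable R : comPzRingType.
Implicit Types (I J : ideal R).

Lemma ideal_leP I J : reflect (I `<=` J) (I <= J)%O.
Proof. exact: asboolP. Qed.

Lemma adic_filterI I (J K : ideal R) :
  (exists n, idealX I n `<=` J) -> (exists n, idealX I n `<=` K) ->
  exists n, idealX I n `<=` (J `&` K)%O.
Proof.
move=> [m mJ] [n nK]; exists (maxn m n) => x Ix; split.
  exact/mJ/(idealX_decr (leq_maxl m n)).
exact/nK/(idealX_decr (leq_maxr m n)).
Qed.

Program Definition adic_filter I : mfilter (ideal R) :=
  @MFilter (ideal R) (fun J => exists n, idealX I n `<=` J) _ _ _.
Next Obligation. by move=> I; exists 0%N. Qed.
Next Obligation. by move=> I J K; apply: adic_filterI. Qed.
Next Obligation.
by move=> I J K /ideal_leP JK [n nJ]; exists n; apply: subset_trans JK.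
Qed.

Lemma has_nbhs0_basis_cofinal (T : Topological R) (B B' : set (set R)) :
  (forall X, B X -> exists2 Y, B' Y & Y `<=` X) ->
  (forall X, B' X -> exists2 Y, B Y & Y `<=` X) ->
  has_nbhs0_basis T B <-> has_nbhs0_basis T B'.
Proof.
move=> BB' B'B; suff fBB' : filter_from B id = filter_from B' id.
  by rewrite /has_nbhs0_basis fBB'.
apply/seteqP; split=> A [X]; [move=> /BB'|move=> /B'B]; move=> [Y BY YX] XA;
  by exists Y => //; apply: subset_trans XA.
Qed.

End AdicFilter.

Section AdicPresentation.
Variables (C : category) (U : functor C CRing).
Variable a : forall A : C, ideal (U A : comPzRingType).

Lemma adic_presentation_exists : compatible a ->
  exists E : ext_presentation (ideal_form U), adic_kernel a E.
Proof.
move=> a_compat.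
pose K (A : C) : mfilter (fib (ideal_form0 U) A) := adic_filter (a A).
have K_pull X Y (f : hom X Y) J : K Y J -> K X (pull (ideal_form0 U) f J).
  move=> [n nJ]; exists n => x /(idealX_pull (a_compat _ _ f)); exact: nJ.
by exists (filter_presentation K_pull) => A; apply: filter_presentation_fibre.
Qed.

(* The topology and the Hausdorff property only see the kernel fibre, so what
   follows holds for every presentation with the adic kernel. *)
Variable E : ext_presentation (ideal_form U).
Hypothesis aE : adic_kernel a E.

Lemma classical_topology_adic A (T : Topological (U A : comPzRingType)) :
  classical_topology E T <-> adic_topology (a A) T.
Proof.
suff basisE : has_nbhs0_basis T
      [set (J : set (U A : comPzRingType)) |
        J in (kernel_fibre E A : set (ideal (U A : comPzRingType)))] <->
    has_nbhs0_basis T [set (idealX (a A) n : set _) | n in [set: nat]].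
  by split=> -[ringT /basisE].
apply: has_nbhs0_basis_cofinal => [_ [J + <-]|_ [n _ <-]].
  by rewrite aE => -[n nJ]; exists (idealX (a A) n) => //; exists n.
exists (idealX (a A) n) => //.
by exists (idealX (a A) n) => //; rewrite aE; exists n.
Qed.

Lemma classical_topology_exists A :
  exists T : Topological (U A : comPzRingType), classical_topology E T.
Proof.
pose K : set (ideal (U A : comPzRingType)) := kernel_fibre E A.
have K0 : K !=set0 by exists (ideal_top _); rewrite /K aE; exists 0%N.
have KD (I J : ideal (U A : comPzRingType)) :
    K I -> K J -> exists2 L, K L & L `<=` I `&` J.
  rewrite /K aE => KI KJ; exists (I `&` J)%O => //.
  exact: adic_filterI.
exists (linear_topology K0 KD); split; first exact: linear_topology_ring.
exact: linear_topology_basis.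
Qed.

(** The infimum of the kernel fibre is the intersection of the powers, since
    these are cofinal in it; and the least ideal is zero. *)
Lemma adic_hausdorff_object A : hausdorff_object E A <->
  \bigcap_n (idealX (a A) n : set (U A : comPzRingType)) = [set 0].
Proof.
pose Z : ideal (U A : comPzRingType) := idealZ 0 (ideal_top _).
have Z0 : Z `<=` [set 0] by move=> _ [x _ <-]; rewrite mul0r.
have X_ker n : kernel_fibre E A (idealX (a A) n) by rewrite aE; exists n.
split=> [[b b_min [_ b_inf]]|X0].
  have capP : is_ideal (\bigcap_n (idealX (a A) n : set (U A : comPzRingType))).
    split=> [n _|x y Ix Iy n _|c x Ix n _]; first exact: ideal0.
      by apply: idealD; [apply: Ix|apply: Iy].
    by apply: ideal_mull; apply: Ix.
  apply/seteqP; split=> [|_ -> n _]; last exact: ideal0.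
  apply: subset_trans Z0; apply/(ideal_leP (Ideal capP) Z).
  apply: le_trans (b_min Z); apply: b_inf => J; rewrite aE => -[n nJ].
  by apply/ideal_leP => x /(_ n Logic.I)/nJ.
exists Z => [J|]; first by apply/ideal_leP => x /Z0 ->; apply: ideal0.
split=> [J _|W W_lb]; first by apply/ideal_leP => x /Z0 ->; apply: ideal0.
apply/ideal_leP => x Wx; have -> : x = 0.
  suff : [set 0] x by [].
  by rewrite -X0 => n _; apply: (ideal_leP W _ (W_lb _ (X_ker n))).
exact: ideal0.
Qed.

End AdicPresentation.

Lemma p_adicE (p : nat) (R : comPzRingType) (T : Topological R) :
  adic_topology (pR p R) T <-> p_adic_topology p T.
Proof.
rewrite /adic_topology /p_adic_topology.
suff -> : [set (idealX (pR p R) n : set R) | n in [set: nat]] =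
    [set [set (p ^ n)%N%:R * x | x in [set: R]] | n in [set: nat]] by [].
by apply: eq_imagel => n _; apply: idealX_pR.
Qed.

Lemma adic_topology_hausdorff (R : comPzRingType) (I : ideal R)
    (T : Topological R) :
  \bigcap_n (idealX I n : set R) = [set 0] -> adic_topology I T ->
  hausdorff_space (Topological.Pack T).
Proof.
move=> I0 [ringT TI].
apply: (@ring_topology_hausdorff _ _ (range (idealX I))) => //.
  by rewrite image_comp.
by rewrite bigcap_image I0.
Qed.

Theorem theorem3p12 :
  (forall (C : category) (U : functor C CRing)
      (a : forall A : C, ideal (U A : comPzRingType)),
    compatible a ->
    (exists E : ext_presentation (ideal_form U), adic_kernel a E) /\
    (forall E : ext_presentation (ideal_form U), adic_kernel a E ->
      forall A : C,
      [/\ exists T : Topological (U A : comPzRingType), classical_topology E T,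
          forall T T' : Topological (U A : comPzRingType),
            classical_topology E T -> classical_topology E T' ->
            @open (Topological.Pack T) = @open (Topological.Pack T'),
          forall T : Topological (U A : comPzRingType),
            classical_topology E T <-> adic_topology (a A) T &
          hausdorff_object E A <->
            \bigcap_n (idealX (a A) n : set (U A : comPzRingType)) = [set 0]]))
  /\
  (forall p : nat, prime p ->
    @compatible CRing (id_functor CRing) (pR p) /\
    (forall E : ext_presentation (ideal_form (id_functor CRing)),
      @adic_kernel CRing (id_functor CRing) (pR p) E ->
      forall (R : CRing) (T : Topological (R : comPzRingType)),
        @classical_topology CRing (id_functor CRing) E R T <->
        p_adic_topology p T))
  /\
  (@compatible IdealPairs pair_forget pair_ideal /\
    (forall E : ext_presentation (ideal_form pair_forget),
      @adic_kernel IdealPairs pair_forget pair_ideal E ->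
      forall (P : IdealPairs) (T : Topological (pair_ring P)),
        @classical_topology IdealPairs pair_forget E P T <->
        adic_topology (pair_ideal P) T))
  /\
  (@compatible NoetherianLocalRings local_forget local_max /\
    (forall E : ext_presentation (ideal_form local_forget),
      @adic_kernel NoetherianLocalRings local_forget local_max E ->
      forall P : NoetherianLocalRings,
        hausdorff_object E P /\
        (forall T : Topological (local_ring P),
          @classical_topology NoetherianLocalRings local_forget E P T <->
          adic_topology (local_max P) T) /\
        (forall T : Topological (local_ring P),
          adic_topology (local_max P) T ->
          hausdorff_space (Topological.Pack T)))).

Proof.
split=> [C U a a_compat|].
  split=> [|E aE A]; first exact: adic_presentation_exists.
  split; [exact: classical_topology_exists aE A| |exact: classical_topology_adic
    |exact: adic_hausdorff_object].
  move=> T T' [ringT TB] [ringT' TB'].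
  exact: ring_topology_open TB ringT' TB'.
split=> [p _|].
  split=> [R S f _ [_ [x _ <-] <-]|E pE R T].
    by exists (fmap (id_functor CRing) f x) => //; rewrite rmorphM rmorph_nat.
  by rewrite -p_adicE; apply: classical_topology_adic.
split.
  split=> [P Q f|E aE P T]; first exact: svalP f.
  exact: classical_topology_adic.
split=> [P Q f|E aE P]; first exact: svalP f.
have krull :=
  krull_intersection_local (@local_noetherian P) (@local_max_unique P).
split; first by apply/(adic_hausdorff_object aE).
by split=> T; [apply: classical_topology_adic|apply: adic_topology_hausdorff].
Qed.
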